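(* Let the matrix $A\in\mathbb{R}^{n\times n}$ of the stable system $\dot x=Ax$ change smoothly depending on a parameter $\gamma$ in such a way that all conventional participation factors remain limited, i.e. for all $k,i$ there exists $C\in\mathbb{R}$ such that $|p_{ki}|<C$, and in such a way that the $i$-th eigenvalue tends to the imaginary axis from the left, while the other eigenvalues are limited: $$\mathrm{Re}(\lambda_i)\to-0,\qquad \mathrm{Re}(\lambda_j)<-\alpha<0\ \text{ for }\lambda_j\neq\lambda_i,\lambda_i^*.$$ Then, under the conventional initial conditions, $E_{z_i}\to+\infty$, and there is at least one state variable $k$ such that the following limiting relations are satisfied for the mode-in-state Lyapunov participation factors: - if $\lambda_i$ is real: $E_{x_ki}\to+\infty$, $e_{ki}\to1$, and $e_{kj}\to0$ for $j\ne i$; - if $\lambda_i$ is complex: $E_{x_ki},E_{x_ki^*}\to+\infty$, $e_{ki},e_{ki^*}\to0.5$, and $e_{kj}\to0$ for $j\ne i,i^*$.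
   Context: $(\cdot)^*$ denotes the conjugate transpose of a matrix or vector (the complex conjugate of a scalar), $(\cdot)^T$ the transpose, and $\{M\}_H=\frac12(M+M^* )$. $\mathbf e_k$ is the $k$-th column of the identity matrix, while $e_{ki}$ (two indices) is a participation factor. The matrix $A$ is stable and has $n$ distinct eigenvalues $\lambda_1,\dots,\lambda_n$; $i^*$ is the index of the eigenvalue $\lambda_i^*$. Eigenvectors: $A=U\Lambda V$, $\Lambda=\mathrm{diag}(\lambda_1,\dots,\lambda_n)$, $U=(u_1\cdots u_n)$, $V=U^{-1}$ with rows $v_1^T,\dots,v_n^T$; $u_i^k$, $v_i^k$ are the $k$-th components of $u_i$, $v_i$. Eigenvectors associated with real eigenvalues are real, eigenvectors associated with a complex conjugate pair of nonreal eigenvalues are complex conjugates of each other, and $|u_i|^2=1$ for all $i$. The conventional participation factors are $p_{ki}=u_i^kv_i^k$. The residue matrices of the resolvent of $A$ are $R_i=u_iv_i^T$. For the system $\dot x=Ax$, $x(0)=x_0$, with mode vector $z(t)=Vx(t)$, the Lyapunov energy of the $i$-th mode is $E_{z_i}=\int_0^\infty z_i^*(t)z_i(t)\,dt$. The Lyapunov energy of the $k$-th state is $E_{x_k}=\int_0^\infty x_k^2(t)\,dt=x_0^TP_{x_k}x_0$, where $A^*P_{x_k}+P_{x_k}A=-\mathbf e_k\mathbf e_k^T$. The part of it associated with the $i$-th mode is $$E_{x_ki}=x_0^T\widetilde P_{x_ki}x_0,\qquad \widetilde P_{x_ki}=-\left\{R_i^*\mathbf e_k\mathbf e_k^T(\lambda_i^*I+A)^{-1}\right\}_H,$$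 so that $E_{x_k}=\sum_{i=1}^nE_{x_ki}$. The mode-in-state Lyapunov participation factor is $e_{ki}=E_{x_ki}/E_{x_k}$. The conventional initial conditions are those in which the initial state is a unit coordinate vector; the quantities $E_{x_k}$, $E_{x_ki}$ and $e_{ki}$ for the $k$-th state are then evaluated at $x_0=\mathbf e_k$, so that $e_{ki}=(\widetilde P_{x_ki})_{kk}\big/\sum_{i'=1}^n(\widetilde P_{x_ki'})_{kk}$.
   Formalization: The matrix A is taken smooth also at the limiting value of the parameter (otherwise rotating eigenvectors defeat any fixed k), and E_{z_i} → +∞ is claimed for the initial state e_k with the same k whose existence is asserted (it fails for some unit vectors when A is diagonal). *)

(* Defs.v *)
From HB Require Import structures.
From mathcomp Require Export all_boot all_order all_algebra.
From mathcomp Require Export all_classical all_reals all_analysis.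
From mathcomp Require Export complex.
Export Order.TTheory GRing.Theory Num.Theory numFieldNormedType.Exports.

Set Implicit Arguments.
Unset Strict Implicit.
Unset Printing Implicit Defensive.

Open Scope classical_set_scope.
Open Scope ring_scope.

Definition smooth_on (R : realType) (n : nat) (O : set R)
    (A : R -> 'M[R]_n) : Prop :=
  forall (m : nat) (k l : 'I_n) (g : R), O g ->
    derivable (derive1n m (fun s => A s k l)) g 1.

Definition toC (R : realType) (m n : nat) (M : 'M[R]_(m, n)) : 'M[R[i]]_(m, n) :=
  map_mx (real_complex R) M.

Definition ctrmx (R : realType) (m n : nat) (M : 'M[R[i]]_(m, n)) :
  'M[R[i]]_(n, m) := (map_mx Num.conj M)^T.

Definition herm (R : realType) (n : nat) (M : 'M[R[i]]_n) : 'M[R[i]]_n :=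
  2^-1 *: (M + ctrmx M).

(* The columns of [U] are the right eigenvectors u_j; the rows of
   [invmx U] are the left eigenvectors v_j^T.  The last field, taken with
   l = j, says that eigenvectors of real eigenvalues are real. *)
Record eigensystem (R : realType) (n : nat) (A : 'M[R]_n)
    (lam : 'I_n -> R[i]) (U : 'M[R[i]]_n) : Prop := Eigensystem {
  eigen_distinct : injective lam;
  eigen_unit : U \in unitmx;
  eigen_decomp : toC A = U *m diag_mx (\row_j lam j) *m invmx U;
  eigen_norm : forall j, \sum_k `|U k j| ^+ 2 = 1;
  eigen_conj : forall j l, lam l = (lam j)^* ->
    col l U = map_mx Num.conj (col j U)
}.

Definition participation (R : realType) (n : nat) (U : 'M[R[i]]_n)
  (k j : 'I_n) : R[i] := U k j * invmx U j k.

Definition residue (R : realType) (n : nat) (U : 'M[R[i]]_n) (j : 'I_n) :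
  'M[R[i]]_n := col j U *m row j (invmx U).

Definition is_trajectory (R : realType) (n : nat) (A : 'M[R]_n)
    (x0 : 'cV[R]_n) (x : R -> 'cV[R]_n) : Prop :=
  x 0 = x0 /\
  forall (t : R) (k : 'I_n),
    is_derive t 1 (fun s => x s k 0) ((A *m x t) k 0).

Definition unit_vec (R : realType) (n : nat) (k : 'I_n) : 'cV[R]_n :=
  delta_mx k 0.

(* The integrand is conj(z_j) z_j, which has zero imaginary part. *)
Definition mode_energy (R : realType) (n : nat) (U : 'M[R[i]]_n)
    (x : R -> 'cV[R]_n) (j : 'I_n) : R :=
  let z t := (invmx U *m toC (x t)) j 0 in
  (\int[lebesgue_measure]_(t in `[0, +oo[) complex.Re ((z t)^* * z t))%R.

Definition state_energy (R : realType) (n : nat)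
    (x : R -> 'cV[R]_n) (k : 'I_n) : R :=
  (\int[lebesgue_measure]_(t in `[0, +oo[) (x t k 0) ^+ 2)%R.

Definition mode_in_state_mx (R : realType) (n : nat) (A : 'M[R]_n)
    (lam : 'I_n -> R[i]) (U : 'M[R[i]]_n) (k j : 'I_n) : 'M[R[i]]_n :=
  - herm (ctrmx (residue U j) *m (toC (unit_vec R k) *m (toC (unit_vec R k))^T)
          *m invmx ((lam j)^*%:M + toC A)).

(* A Hermitian form at a real vector, hence real. *)
Definition mode_in_state_energy (R : realType) (n : nat) (A : 'M[R]_n)
    (lam : 'I_n -> R[i]) (U : 'M[R[i]]_n) (x0 : 'cV[R]_n) (k j : 'I_n) : R :=
  complex.Re (((toC x0)^T *m mode_in_state_mx A lam U k j *m toC x0) 0 0).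

Definition lyap_participation (R : realType) (n : nat) (A : 'M[R]_n)
    (lam : 'I_n -> R[i]) (U : 'M[R[i]]_n) (x : R -> 'cV[R]_n)
    (k j : 'I_n) : R :=
  mode_in_state_energy A lam U (x 0) k j / state_energy x k.

(* Main.v *)
Require Import Defs.
From mathcomp Require Import ring lra.

Set Implicit Arguments.
Unset Strict Implicit.
Unset Printing Implicit Defensive.

(** Fix a state k, put p_j = U_kj V_jk with V = U^-1, and eps = - Re lambda_i.
    Along the trajectory started at the k-th unit vector every mode solves
    z_j' = lambda_j z_j with z_j(0) = V_jk, and x_k = sum_j U_kj z_j.
    Expanding x_k^2 = conj(x_k) x_k and integrating term by term gives
    E_xk = sum_j E_xkj and E_xkj = sum_l w_jl, where
    w_jl = - Re (conj(p_j) p_l / (conj(lambda_j) + lambda_l))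
    ([state_energyE], [mode_in_state_energy_sum]).

    Let S = {i, istar}. A term w_jl with j or l outside S is at most C^2/alpha
    in absolute value. The terms of S contribute to E_xki at least
    (Re p_i)^2 / (2 eps): when lambda_i is nonreal the cross term
    w_{i,istar} may be comparable to w_ii, because lambda_i may tend to 0, but
    completing a square saves the bound ([crossterm_energy]). Moreover
    E_xk istar = E_xki by complex conjugation. Hence, as soon as Re p_i stays
    away from 0, E_xki blows up, E_xk = #|S| E_xki + O(1), and the shares e_kj
    tend to 1/#|S| inside S and to 0 outside; E_zi, at least
    (Re p_i)^2 / (2 eps) too, blows up as well.

    There remains to find one k for which Re p_ki stays away from 0 for all
    parameters close to g0 ([marginal_participation_bounded_away]). The number
    sum_(j in S) p_kj is a diagonal entry of the spectral projector of A on
    the eigenvectors of S, and it equals Re p_ki or 2 Re p_ki. This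
    projector has trace #|S|, so it suffices that it converges: some diagonal
    entry of the limit is then nonzero. For convergence, take
    M = A^2 - 2 Re(lambda_i) A + |lambda_i|^2, whose kernel is spanned by the
    eigenvectors of S. Its characteristic polynomial is 'X^#|S| q, where
    q(0) is a product of nonzero eigenvalues of M and so stays away from 0, and
    the projector is q(M) / q(0): a continuous function of M as long as q(0)
    is bounded away from 0. The two eigenvalues of S may collide in the limit, but
    the projector on both together still converges. Finally M converges since |lambda_i|^2 does
    ([cvg_sqr_modulus]). *)

(** * Complex numbers and the algebra of mode energies *)

Section ComplexFacts.
Variable R : realType.
Implicit Types z w : R[i].
Local Notation normc := (@Normc.normc R).

Lemma Re_add z w : complex.Re (z + w) = complex.Re z + complex.Re w.
Proof. by case: z; case: w. Qed.

Lemma Im_add z w : complex.Im (z + w) = complex.Im z + complex.Im w.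
Proof. by case: z; case: w. Qed.

Lemma Re_opp z : complex.Re (- z) = - complex.Re z.
Proof. by case: z. Qed.

Lemma Re_sum (I : finType) (P : pred I) (F : I -> R[i]) :
  complex.Re (\sum_(j | P j) F j) = \sum_(j | P j) complex.Re (F j).
Proof. exact: (big_morph _ Re_add). Qed.

Lemma Re_conj z : complex.Re z^* = complex.Re z.
Proof. by case: z. Qed.

Lemma Im_conj z : complex.Im z^* = - complex.Im z.
Proof. by case: z. Qed.

Lemma normc_ge0 z : 0 <= normc z.
Proof. by case: z => a b; apply: sqrtr_ge0. Qed.

Lemma normc_conj z : normc z^* = normc z.
Proof. by case: z => a b; rewrite /= sqrrN. Qed.

Lemma sqr_normc_ReIm z : normc z ^+ 2 = complex.Re z ^+ 2 + complex.Im z ^+ 2.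
Proof. by case: z => a b; rewrite sqr_sqrtr // addr_ge0 // sqr_ge0. Qed.

Lemma Re_conj_mul z : complex.Re (z^* * z) = normc z ^+ 2.
Proof. by rewrite sqr_normc_ReIm; case: z => a b /=; rewrite mulNr opprK -!expr2. Qed.

Lemma Re_le_normc z : `|complex.Re z| <= normc z.
Proof.
rewrite -(@ler_pXn2r _ 2) ?nnegrE ?normc_ge0 // sqr_normc_ReIm real_normK ?num_real //.
by rewrite lerDl sqr_ge0.
Qed.

Lemma normc_div z w : normc (z / w) = normc z / normc w.
Proof. by rewrite Normc.normcM Normc.normcV. Qed.

Lemma normc_sum (I : finType) (P : pred I) (F : I -> R[i]) :
  normc (\sum_(j | P j) F j) <= \sum_(j | P j) normc (F j).
Proof.
elim/big_rec2: _ => [|j y z _ le_zy]; first by rewrite Normc.normc0.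
exact: le_trans (le_normcD _ _) (lerD _ _).
Qed.

Lemma real_complex_Re z : complex.Im z = 0 -> z = real_complex R (complex.Re z).
Proof. by case: z => a b /= ->. Qed.


Lemma map_conj_toC m n (M : 'M[R]_(m, n)) : map_mx Num.conj (toC M) = toC M.
Proof. by apply/matrixP => a b; rewrite !mxE; apply: conjc_real. Qed.

(** The case j = l of a pair energy: the denominator is twice a real part. *)
Lemma selfterm_energy z w : complex.Re w < 0 ->
  - complex.Re (z^* * z / (w^* + w)) = normc z ^+ 2 / (- complex.Re w *+ 2).
Proof.
rewrite sqr_normc_ReIm; case: z w => r s [a b] /= a_lt0.
have -> : - b + b = 0 by rewrite addNr.
rewrite expr0n addr0 mul0r oppr0 mulr0 subr0 -mulr2n.
by field; rewrite lt_eqF.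
Qed.

(** With z = r + i s and w = a + i b, the difference of the two sides is
    (s b + a r)^2 / (- 2 a (a^2 + b^2)), which is nonnegative for a < 0. The
    bound involves Re z only: for z purely imaginary and w real the two terms
    cancel. *)
Lemma crossterm_energy z w : complex.Re w < 0 ->
  (complex.Re z) ^+ 2 / (- complex.Re w *+ 2) <=
  - complex.Re (z^* * z / (w^* + w)) - complex.Re (z^* * z^* / (w^* + w^*)).
Proof.
move=> w_lt0; rewrite selfterm_energy // sqr_normc_ReIm -subr_ge0.
case: z w w_lt0 => r s [a b] /= a_lt0.
have a_neq0 : a != 0 by rewrite lt_eqF.
have ab_gt0 : 0 < a ^+ 2 + b ^+ 2.
  by rewrite ltr_pwDl ?sqr_ge0 // exprn_even_gt0.
rewrite [X in 0 <= X](_ : _ = (s * b + a * r) ^+ 2 / (- (a *+ 2) * (a ^+ 2 + b ^+ 2))).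
  by rewrite divr_ge0 ?sqr_ge0 // mulr_ge0 ?(ltW ab_gt0) // oppr_ge0 mulrn_wle0 // ltW.
have -> : (a + a) ^+ 2 + (- b - b) ^+ 2 = 4 * (a ^+ 2 + b ^+ 2) by ring.
field; rewrite gt_eqF // a_neq0 gt_eqF // mulr_gt0 //.
Qed.

End ComplexFacts.

Lemma sum_participation (R : realType) (n : nat) (U : 'M[R[i]]_n) j :
  U \in unitmx -> \sum_k participation U k j = 1.
Proof.
move=> Uu; have /matrixP/(_ j j) := mulVmx Uu.
rewrite !mxE eqxx => sumE; apply: etrans sumE.
by apply: eq_bigr => k _; rewrite /participation mulrC.
Qed.

Section Spectral.
Variables (R : realType) (n : nat) (A : 'M[R]_n) (lam : 'I_n -> R[i]).
Variable (U : 'M[R[i]]_n).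
Hypothesis eigA : eigensystem A lam U.
Local Notation V := (invmx U).
Local Notation p := (participation U).

Lemma eigen_left : V *m toC A = diag_mx (\row_j lam j) *m V.
Proof.
by rewrite (eigen_decomp eigA) !mulmxA mulVmx ?mul1mx // (eigen_unit eigA).
Qed.

Lemma eigen_right : toC A *m U = U *m diag_mx (\row_j lam j).
Proof.
by rewrite (eigen_decomp eigA) -!mulmxA mulVmx ?mulmx1 // (eigen_unit eigA).
Qed.


Lemma normc_eigenvector_le1 k j : Normc.normc (U k j) <= 1.
Proof.
have := eigen_norm eigA j; rewrite (bigD1 k) //= => sumE.
have : `|U k j| ^+ 2 <= 1.
  by rewrite -sumE lerDl sumr_ge0 // => l _; rewrite exprn_ge0.
rewrite expr_le1 //  normc_def => /andP[_ /= le1]; move: le1.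
by case: (U k j).
Qed.

Lemma shifted_decomp s : s%:M + toC A = U *m diag_mx (\row_l (s + lam l)) *m V.
Proof.
have -> : diag_mx (\row_l (s + lam l)) = s%:M + diag_mx (\row_j lam j).
  by apply/matrixP => a b; rewrite !mxE mulrnDl.
rewrite mulmxDr mulmxDl -(eigen_decomp eigA) mul_mx_scalar -scalemxAl.
by rewrite mulmxV ?scalemx1 // (eigen_unit eigA).
Qed.

Lemma diag_conjugate_entry (d : 'I_n -> R[i]) k :
  (U *m diag_mx (\row_l d l) *m V) k k = \sum_l p k l * d l.
Proof.
rewrite mxE; apply: eq_bigr => l _; rewrite mul_mx_diag !mxE.
by rewrite /participation mulrAC.
Qed.

(** The resolvent is diagonal in the eigenbasis. *)
Lemma resolvent_entry k s : (forall l, s + lam l != 0) ->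
  invmx (s%:M + toC A) k k = \sum_l p k l / (s + lam l).
Proof.
move=> s_reg; rewrite -diag_conjugate_entry.
set d := diag_mx _; have Uu := eigen_unit eigA.
have invE : (s%:M + toC A) *m (U *m d *m V) = 1%:M.
  rewrite shifted_decomp !mulmxA mulmxKV // -[U *m _ *m d]mulmxA mulmx_diag.
  transitivity (U *m 1%:M *m V); last by rewrite mulmx1 mulmxV.
  congr (_ *m _ *m _).
  by apply/matrixP => a b; rewrite !mxE divff.
have unitS := (mulmx1_unit invE).1.
by rewrite -(mulKmx unitS (U *m d *m V)) invE mulmx1.
Qed.

Hypothesis stable : forall j, complex.Re (lam j) < 0.

Lemma conj_eigen_sum_neq0 j l : (lam j)^* + lam l != 0.
Proof.
apply/eqP => /(congr1 (@complex.Re R)); rewrite Re_add Re_conj /= => E.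
by move: (stable j) (stable l); lra.
Qed.

(** Against the unit vector, the Hermitian part is the real part of one
    diagonal entry, which factors into the diagonal entries of the residue
    and of the resolvent. *)
Lemma mode_in_state_energyE k j :
  mode_in_state_energy A lam U (unit_vec R k) k j =
  - complex.Re ((p k j)^* * (\sum_l p k l / ((lam j)^* + lam l))).
Proof.
rewrite /mode_in_state_energy /mode_in_state_mx /herm.
have unitE : toC (unit_vec R k) = delta_mx k 0.
  by apply/matrixP => a b; rewrite !mxE; case: (_ && _).
rewrite unitE trmx_delta -rowE -colE !mulmxA -colE -mulmxA -rowE.
rewrite !mxE !big_ord1 !mxE !big_ord1 !mxE -resolvent_entry; last first.
  by move=> l; apply: conj_eigen_sum_neq0.
rewrite Re_opp; congr (- _); set z : R[i] := _ * _; rewrite -/(participation U k j) -/z.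
have -> : 2^-1 = real_complex R 2^-1 by rewrite fmorphV rmorph_nat.
by case: z => a b /=; field.
Qed.


(** The integral over positive times of Re (conj(U_kj z_j) U_kl z_l), along the
    trajectory started at the k-th unit vector. *)
Definition pair_energy k j l : R :=
  - complex.Re ((p k j)^* * p k l / ((lam j)^* + lam l)).

Lemma mode_in_state_energy_sum k j :
  mode_in_state_energy A lam U (unit_vec R k) k j = \sum_l pair_energy k j l.
Proof.
rewrite mode_in_state_energyE mulr_sumr Re_sum -sumrN.
by apply: eq_bigr => l _; rewrite mulrA.
Qed.

Lemma pair_energy_bound k j l C alpha : 0 < alpha ->
  Normc.normc (p k j) <= C -> Normc.normc (p k l) <= C ->
  complex.Re (lam j) + complex.Re (lam l) <= - alpha ->
  `|pair_energy k j l| <= C ^+ 2 / alpha.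
Proof.
move=> alpha_gt0 pj_le pl_le lam_le.
rewrite /pair_energy normrN (le_trans (@Re_le_normc R _)) // normc_div Normc.normcM normc_conj.
have den : alpha <= Normc.normc ((lam j)^* + lam l).
  apply: le_trans (@Re_le_normc R _); rewrite Re_add Re_conj ler0_norm; lra.
apply: ler_pM; rewrite ?mulr_ge0 ?invr_ge0 ?normc_ge0 //.
  by rewrite expr2 ler_pM ?normc_ge0.
by rewrite lef_pV2 ?posrE // (lt_le_trans alpha_gt0).
Qed.

(** The conjugate of a left eigenvector is a left eigenvector for the conjugate
    eigenvalue, because A is real; in the eigenbasis it is supported on l since
    the eigenvalues are distinct, and its coefficient there is 1 because the
    right eigenvectors are conjugate too. *)
Lemma left_eigenvector_conj j l : lam l = (lam j)^* ->
  row l V = map_mx Num.conj (row j V).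
Proof.
move=> lam_l; have Uu := eigen_unit eigA.
pose w := map_mx Num.conj (row j V) *m U.
have wE : w *m diag_mx (\row_h lam h) = (lam j)^* *: w.
  rewrite /w -mulmxA -eigen_right mulmxA.
  rewrite -[toC A]map_conj_toC -map_mxM -row_mul eigen_left row_mul row_diag_mx -scalemxAl.
  by rewrite -rowE map_mxZ mxE scalemxAl.
have w_l : w = delta_mx 0 l.
  apply/rowP => h; rewrite [RHS]mxE eqxx /=.
  have [->|h_neq] := eqVneq h l.
    rewrite mxE.
    have := congr1 (fun M : 'M[R[i]]_n => (M j j)^*) (mulVmx Uu).
    rewrite !mxE eqxx rmorph1 rmorph_sum /= => E; apply: etrans E.
    apply: eq_bigr => m _; rewrite rmorphM !mxE.
    by have /matrixP/(_ m 0) := eigen_conj eigA lam_l; rewrite !mxE => ->.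
  move: w wE => w /rowP/(_ h); rewrite mul_mx_diag !mxE mulrC => E.
  have : (lam h - (lam j)^*) * w 0 h = 0 by rewrite mulrBl E subrr.
  move/eqP; rewrite mulf_eq0 subr_eq0 -lam_l (inj_eq (eigen_distinct eigA)).
  by rewrite (negPf h_neq) /= => /eqP.
by rewrite rowE -w_l /w mulmxK.
Qed.

Lemma participation_conj k j l : lam l = (lam j)^* -> p k l = (p k j)^*.
Proof.
move=> lam_l; have /matrixP/(_ k 0) := eigen_conj eigA lam_l.
have /matrixP/(_ 0 k) := left_eigenvector_conj lam_l.
by rewrite /participation rmorphM !mxE => -> ->.
Qed.

(** Conjugating the product of the participation factor with the resolvent
    entry of the real matrix A exchanges the two modes and keeps the real part. *)
Lemma mode_in_state_energy_conj k j l : lam l = (lam j)^* ->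
  mode_in_state_energy A lam U (unit_vec R k) k l =
  mode_in_state_energy A lam U (unit_vec R k) k j.
Proof.
move=> lam_l; rewrite !mode_in_state_energyE; congr (- _).
rewrite -!resolvent_entry; try by move=> h; apply: conj_eigen_sum_neq0.
rewrite (participation_conj k lam_l) lam_l !conjCK -[RHS]Re_conj rmorphM /= conjCK.
have conj_entry (M : 'M[R[i]]_n) : (M k k)^* = (map_mx Num.conj M) k k by rewrite mxE.
by rewrite conj_entry map_invmx map_mxD map_scalar_mx /= map_conj_toC conjCK.
Qed.

End Spectral.

(** * Energies of trajectories as integrals of exponential sums *)

Lemma cvg_sum_fin (R : realType) (T : Type) (F : set_system T) (FF : Filter F)
  (I : finType) (f : I -> T -> R) (a : I -> R) :
  (forall j, f j t @[t --> F] --> a j) ->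
  (\sum_j f j t) @[t --> F] --> \sum_j a j.
Proof.
by move=> fa; apply: cvg_big; [exact: add_continuous|move=> j _; exact: fa].
Qed.

Section ComplexCurves.
Variable R : realType.
Implicit Types (y z w : R -> R[i]) (t : R).

(** Differentiability of a complex-valued function of a real variable, taken
    componentwise, so that one can use the calculus of real functions. *)
Definition is_cderive y t (dy : R[i]) : Prop :=
  is_derive t 1 (fun s => complex.Re (y s)) (complex.Re dy) /\
  is_derive t 1 (fun s => complex.Im (y s)) (complex.Im dy).

Lemma is_cderive_cst (c : R[i]) t : is_cderive (fun=> c) t 0.
Proof. by split; apply: is_derive_cst. Qed.

Lemma is_cderiveD y z t dy dz : is_cderive y t dy -> is_cderive z t dz ->
  is_cderive (fun s => y s + z s) t (dy + dz).
Proof.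
move=> [yR yI] [zR zI]; split.
  under [fun s => _]funext do rewrite Re_add; rewrite Re_add; exact: is_deriveD.
by under [fun s => _]funext do rewrite Im_add; rewrite Im_add; exact: is_deriveD.
Qed.

Lemma is_cderive_sum (I : finType) (y : I -> R -> R[i]) t (dy : I -> R[i]) :
  (forall j, is_cderive (y j) t (dy j)) ->
  is_cderive (fun s => \sum_j y j s) t (\sum_j dy j).
Proof.
move=> y_deriv; rewrite (_ : (fun s => _) = \sum_j y j); last first.
  by apply/funext => s; rewrite fct_sumE.
elim/big_ind2: _ => [|z dz w dw|j _]; [exact: is_cderive_cst| |exact: y_deriv].
exact: is_cderiveD.
Qed.

Lemma is_cderiveM y z t dy dz : is_cderive y t dy -> is_cderive z t dz ->
  is_cderive (fun s => y s * z s) t (dy * z t + y t * dz).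
Proof.
move=> [yR yI] [zR zI]; split.
  rewrite (_ : (fun s => _) = (fun s => complex.Re (y s)) * (fun s => complex.Re (z s)) -
     (fun s => complex.Im (y s)) * (fun s => complex.Im (z s))); last first.
    by apply/funext => s; rewrite !fctE; case: (y s); case: (z s).
  apply: is_derive_eq; rewrite /GRing.scale /=.
  by case: (y t) (z t) dy dz {yR yI zR zI} => a b [c d] [e f] [g h] /=; ring.
rewrite (_ : (fun s => _) = (fun s => complex.Re (y s)) * (fun s => complex.Im (z s)) +
   (fun s => complex.Im (y s)) * (fun s => complex.Re (z s))); last first.
  by apply/funext => s; rewrite !fctE; case: (y s); case: (z s).
apply: is_derive_eq; rewrite /GRing.scale /=.
by case: (y t) (z t) dy dz {yR yI zR zI} => a b [c d] [e f] [g h] /=; ring.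
Qed.

Lemma is_cderiveZ (c : R[i]) y t dy : is_cderive y t dy ->
  is_cderive (fun s => c * y s) t (c * dy).
Proof.
move=> y_deriv; have := is_cderiveM (is_cderive_cst c t) y_deriv.
by rewrite mul0r add0r.
Qed.

Lemma is_cderive_conj y t dy : is_cderive y t dy ->
  is_cderive (fun s => (y s)^*) t dy^*.
Proof.
move=> [yR yI]; split.
  by under [fun s => _]funext do rewrite Re_conj; rewrite Re_conj.
under [fun s => _]funext do rewrite Im_conj.
rewrite Im_conj; exact: is_deriveN.
Qed.

Variables (y : R -> R[i]) (mu : R[i]).
Hypothesis y_exp : forall t, is_cderive y t (mu * y t).

(** The derivative of |y|^2 exp (- 2 Re(mu) t) vanishes. This determines the
    modulus, which is all that the decay estimates need, without a complex
    exponential. *)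
Lemma sqr_normc_exponential t :
  Normc.normc (y t) ^+ 2 = Normc.normc (y 0) ^+ 2 * expR (complex.Re mu *+ 2 * t).
Proof.
pose a := complex.Re mu *+ 2.
pose f s := complex.Re ((y s)^* * y s) * expR (- a * s).
suff /(_ t 0) : forall u v, f u = f v.
  rewrite /f !Re_conj_mul mulr0 expR0 mulr1 mulNr expRN -/a => <-.
  by rewrite divfK // gt_eqF // expR_gt0.
move=> u v; apply: is_derive_0_is_cst => s.
have [yR _] := is_cderiveM (is_cderive_conj (y_exp s)) (y_exp s).
have expD : is_derive s 1 (fun s => expR (- a * s)) (- a * expR (- a * s)).
  by apply: is_derive_eq; rewrite /GRing.scale /= mulr1 mulrC.
apply: is_derive_eq; rewrite /GRing.scale /= /a; set e := expR _.
by case: (y s) (mu) => b c [g h] /=; ring.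
Qed.

Lemma normc_exponential t :
  Normc.normc (y t) = Normc.normc (y 0) * expR (complex.Re mu * t).
Proof.
apply/eqP; rewrite -(@eqrXn2 _ 2) ?mulr_ge0 ?normc_ge0 ?expR_ge0 //.
rewrite sqr_normc_exponential exprMn; apply/eqP; congr (_ * _).
by rewrite expr2 -expRD mulrnAl mulr2n.
Qed.

Lemma normc_exponential_cvg0 : complex.Re mu < 0 ->
  Normc.normc (y t) @[t --> +oo] --> 0.
Proof.
move=> mu_lt0; under [fun t => _]funext do rewrite normc_exponential.
suff : Normc.normc (y 0) * expR (complex.Re mu * t) @[t --> +oo] -->
    Normc.normc (y 0) * 0 by rewrite mulr0.
apply: cvgM; first exact: cvg_cst.
rewrite (_ : (fun t => _) = (fun t => expR (- t)) \o (fun t => - complex.Re mu * t)).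
  apply: (@cvg_comp _ _ _ _ _ _ +oo); last exact: cvgr_expR.
  apply: gt0_cvgMry; first by rewrite oppr_gt0.
  by [].
by apply/funext => t /=; rewrite mulNr opprK.
Qed.
End ComplexCurves.

Section ExponentialSums.
Variables (R : realType) (I : finType).
Variables (c mu : I -> R[i]) (y : I -> R -> R[i]).
Hypothesis y_exp : forall m t, is_cderive (y m) t (mu m * y m t).
Hypothesis mu_lt0 : forall m, complex.Re (mu m) < 0.

Let f t : R := complex.Re (\sum_m c m * y m t).

(** The antiderivative sum_m (c_m / mu_m) y_m vanishes at infinity. *)
Lemma integral_exponential_sum : (forall t, 0 <= f t) ->
  (\int[lebesgue_measure]_(t in `[0%R, +oo[) f t)%R =
  - complex.Re (\sum_m c m * y m 0 / mu m).
Proof.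
move=> f_ge0; pose F t := complex.Re (\sum_m (c m / mu m) * y m t).
have fD (t : R) : derivable f t 1.
  have [fR _] := is_cderive_sum (fun m => is_cderiveZ (c m) (y_exp m t)).
  by case: fR.
have FD (t : R) : is_derive t 1 F (f t).
  have [FR _] := is_cderive_sum (fun m => is_cderiveZ (c m / mu m) (y_exp m t)).
  apply: is_derive_eq; rewrite /f; congr complex.Re; apply: eq_bigr => m _.
  rewrite mulrA divfK //; apply: contraTneq (mu_lt0 m) => ->.
  by rewrite ltxx.
have cont (g : R -> R) (t : R) : derivable g t 1 -> {for t, continuous g}.
  by move=> /derivable1_diffP/differentiable_continuous.
have F_cvg : F t @[t --> +oo] --> 0.
  pose G t := \sum_m Normc.normc (c m / mu m) * Normc.normc (y m t).
  have G0 : G t @[t --> +oo] --> 0.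
    suff : G t @[t --> +oo] --> \sum_m Normc.normc (c m / mu m) * 0.
      by rewrite big1 // => m _; rewrite mulr0.
    apply: cvg_sum_fin => m.
    apply: cvgM; first exact: cvg_cst.
    exact: normc_exponential_cvg0 (y_exp m) (mu_lt0 m).
  apply: norm_cvg0; apply: squeeze_cvgr (cvg_cst 0) G0.
  near=> t; rewrite normr_ge0 /= (le_trans (@Re_le_normc R _)) //.
  rewrite (le_trans (normc_sum _ _)) // ler_sum // => m _.
  by rewrite Normc.normcM.
rewrite (@Rintegral_ge0_continuous_FTC2y _ f F 0 0) //.
- rewrite sub0r; congr (- complex.Re _); apply: eq_bigr => m _.
  by rewrite mulrAC.
- by apply: continuous_subspaceT => t; apply: cont.
- by apply: cvg_at_right_filter; apply: cont; case: (FD 0).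
- by move=> t _; rewrite derive1E; case: (FD t).
Unshelve. all: by end_near. Qed.
End ExponentialSums.

Section Trajectories.
Variables (R : realType) (n : nat) (A : 'M[R]_n) (lam : 'I_n -> R[i]).
Variables (U : 'M[R[i]]_n) (k : 'I_n) (x : R -> 'cV[R]_n).
Hypothesis eigA : eigensystem A lam U.
Hypothesis stable : forall j, complex.Re (lam j) < 0.
Hypothesis x_traj : is_trajectory A (unit_vec R k) x.
Local Notation V := (invmx U).

Let z j t : R[i] := (V *m toC (x t)) j 0.

Lemma mode_is_cderive j t : is_cderive (z j) t (lam j * z j t).
Proof.
have -> : lam j * z j t = \sum_m V j m * real_complex R ((A *m x t) m 0).
  transitivity ((V *m toC (A *m x t)) j 0); last first.
    by rewrite mxE; apply: eq_bigr => m _; rewrite [toC _ _ _]mxE.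
  rewrite /toC map_mxM mulmxA (eigen_left eigA) -mulmxA mul_diag_mx mxE.
  by rewrite [in X in _ = X * _]mxE.
rewrite (_ : z j = fun s => \sum_m V j m * real_complex R (x s m 0)); last first.
  by apply/funext => s; rewrite /z mxE; apply: eq_bigr => m _; rewrite [toC _ _ _]mxE.
apply: is_cderive_sum => m; apply: is_cderiveZ.
by split; [exact: x_traj.2|exact: is_derive_cst].
Qed.

Lemma mode_init j : z j 0 = V j k.
Proof.
rewrite /z x_traj.1; have -> : toC (unit_vec R k) = delta_mx k 0.
  by apply/matrixP => a b; rewrite !mxE; case: (_ && _).
by rewrite -colE mxE.
Qed.

Lemma mode_product_is_cderive j l t :
  is_cderive (fun s => (z j s)^* * z l s) t
    (((lam j)^* + lam l) * ((z j t)^* * z l t)).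
Proof.
have := is_cderiveM (is_cderive_conj (mode_is_cderive j t)) (mode_is_cderive l t).
by congr is_cderive; rewrite rmorphM; ring.
Qed.

Lemma Re_conj_eigen_sum_lt0 j l : complex.Re ((lam j)^* + lam l) < 0.
Proof. by rewrite Re_add Re_conj; move: (stable j) (stable l); lra. Qed.

(** A sum with one exponential, conj(z_j) z_j, of exponent 2 Re lambda_j. *)
Lemma mode_energyE j :
  mode_energy U x j = Normc.normc (V j k) ^+ 2 / (- complex.Re (lam j) *+ 2).
Proof.
have := @integral_exponential_sum R 'I_1 (fun=> 1) (fun=> (lam j)^* + lam j)
  (fun _ t => (z j t)^* * z j t) (fun _ => mode_product_is_cderive j j)
  (fun _ => Re_conj_eigen_sum_lt0 j j).
under eq_Rintegral do rewrite big_ord1 mul1r.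
rewrite /mode_energy => ->; last first.
  by move=> t; rewrite big_ord1 mul1r Re_conj_mul sqr_ge0.
by rewrite big_ord1 mul1r selfterm_energy // mode_init.
Qed.

Lemma state_modes t : real_complex R (x t k 0) = \sum_j U k j * z j t.
Proof.
have : toC (x t) = U *m (V *m toC (x t)).
  by rewrite mulmxA mulmxV ?mul1mx // (eigen_unit eigA).
by move/matrixP/(_ k 0); rewrite mxE => ->; rewrite mxE.
Qed.

(** The square of the real number x_k is conj(x_k) x_k, a sum over pairs of
    modes of the exponentials conj(z_j) z_l; the pairs with first member j
    integrate to the part of mode j. *)
Lemma state_energyE : state_energy x k =
  \sum_j mode_in_state_energy A lam U (unit_vec R k) k j.
Proof.
have sumE t : complex.Re (\sum_(m : 'I_n * 'I_n) (U k m.1)^* * U k m.2 *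
    ((z m.1 t)^* * z m.2 t)) = x t k 0 ^+ 2.
  have -> : x t k 0 ^+ 2 =
      complex.Re ((real_complex R (x t k 0))^* * real_complex R (x t k 0)).
    by rewrite /= oppr0 mulr0 subr0 expr2.
  rewrite state_modes rmorph_sum mulr_suml; congr complex.Re.
  rewrite -(pair_bigA _ (fun j l => (U k j)^* * U k l * ((z j t)^* * z l t))) /=.
  apply: eq_bigr => j _; rewrite mulr_sumr; apply: eq_bigr => l _; rewrite rmorphM /=; ring.
have := @integral_exponential_sum R _ (fun m : 'I_n * 'I_n => (U k m.1)^* * U k m.2)
  (fun m => (lam m.1)^* + lam m.2)
  (fun m t => (z m.1 t)^* * z m.2 t) (fun m => mode_product_is_cderive m.1 m.2)
  (fun m => Re_conj_eigen_sum_lt0 m.1 m.2).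
rewrite /state_energy; under eq_Rintegral do rewrite sumE.
move=> ->; last by move=> t; rewrite sumE sqr_ge0.
rewrite Re_sum -sumrN -(pair_bigA _ (fun j l => - complex.Re
  ((U k j)^* * U k l * ((z j 0)^* * z l 0) / ((lam j)^* + lam l)))) /=.
apply: eq_bigr => j _.
rewrite mode_in_state_energy_sum //; apply: eq_bigr => l _.
rewrite /pair_energy /participation !mode_init rmorphM; congr (- complex.Re (_ / _)).
by rewrite /=; ring.
Qed.
End Trajectories.

(** * Limits of spectral projectors *)

Section CoefficientwiseLimits.
Variables (R : realType) (T : Type) (F : set_system T).
Context {FF : Filter F}.

(** Coefficientwise limits make the characteristic polynomial continuous in
    the matrix without a topology on polynomials. *)
Definition cvg_coef (p : T -> {poly R}) (p0 : {poly R}) : Prop :=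
  forall m, (p t)`_m @[t --> F] --> p0`_m.

Definition cvg_entry n (M : T -> 'M[R]_n) (M0 : 'M[R]_n) : Prop :=
  forall a b, M t a b @[t --> F] --> M0 a b.

Lemma cvg_coef_cst p0 : cvg_coef (fun=> p0) p0.
Proof. by move=> m; apply: cvg_cst. Qed.

Lemma cvg_coefC (c : T -> R) (c0 : R) : c t @[t --> F] --> c0 ->
  cvg_coef (fun t => (c t)%:P) c0%:P.
Proof.
move=> cc0 [|m]; under [fun t => _]funext do rewrite coefC /=; rewrite coefC //=.
exact: cvg_cst.
Qed.

Lemma cvg_coefB p p0 q q0 : cvg_coef p p0 -> cvg_coef q q0 ->
  cvg_coef (fun t => p t - q t) (p0 - q0).
Proof.
move=> pp0 qq0 m; under [fun t => _]funext do rewrite coefB; rewrite coefB.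
exact: cvgB.
Qed.

Lemma cvg_coefM p p0 q q0 : cvg_coef p p0 -> cvg_coef q q0 ->
  cvg_coef (fun t => p t * q t) (p0 * q0).
Proof.
move=> pp0 qq0 m; under [fun t => _]funext do rewrite coefM; rewrite coefM.
by apply: cvg_sum_fin => j; apply: cvgM.
Qed.

Lemma cvg_coef_sum (I : finType) (p : I -> T -> {poly R}) p0 :
  (forall j, cvg_coef (p j) (p0 j)) ->
  cvg_coef (fun t => \sum_j p j t) (\sum_j p0 j).
Proof.
move=> pp0 m; under [fun t => _]funext do rewrite coef_sum; rewrite coef_sum.
by apply: cvg_sum_fin => j; apply: pp0.
Qed.

Lemma cvg_coef_prod (I : finType) (p : I -> T -> {poly R}) p0 :
  (forall j, cvg_coef (p j) (p0 j)) ->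
  cvg_coef (fun t => \prod_j p j t) (\prod_j p0 j).
Proof.
move=> pp0; rewrite (_ : (fun t => _) = \prod_j p j); last first.
  by apply/funext => t; rewrite fct_prodE.
elim/big_ind2: _ => [|u v q w vu wq|j _]; [exact: cvg_coef_cst| |exact: pp0].
exact: cvg_coefM.
Qed.

Variables (n : nat) (M : T -> 'M[R]_n) (M0 : 'M[R]_n).
Hypothesis MM0 : cvg_entry M M0.

Lemma cvg_char_poly : cvg_coef (fun t => char_poly (M t)) (char_poly M0).
Proof.
apply: cvg_coef_sum => s; apply: cvg_coefM; first exact: cvg_coef_cst.
apply: cvg_coef_prod => j; under [fun t => _]funext do rewrite !mxE.
rewrite !mxE; apply: cvg_coefB; first exact: cvg_coef_cst.
exact: cvg_coefC.
Qed.

Lemma cvg_entryM (N : T -> 'M[R]_n) N0 : cvg_entry N N0 ->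
  cvg_entry (fun t => M t *m N t) (M0 *m N0).
Proof.
move=> NN0 a b; under [fun t => _]funext do rewrite mxE; rewrite mxE.
by apply: cvg_sum_fin => j; apply: cvgM.
Qed.

End CoefficientwiseLimits.

Section Projector.
Variables (R : realType) (n : nat).
Variables (M : 'M[R]_n) (U : 'M[R[i]]_n) (d : 'I_n -> R[i]) (S : {set 'I_n}).

(** This is q(M), where char_poly M = 'X^#|S| q; its entries are polynomials in
    those of M, which makes it continuous in M. *)
Definition projector_numerator : 'M[R]_n :=
  \sum_(m < n.+1) (char_poly M)`_(#|S| + m) *: iter m (mulmx M) 1%:M.

Hypothesis Uu : U \in unitmx.
Hypothesis decompM : toC M = U *m diag_mx (\row_j d j) *m invmx U.
Hypothesis ker_d : forall j, j \in S -> d j = 0.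

(** Similar matrices have the same characteristic polynomial, and the
    eigenvalues indexed by S each give a factor 'X. *)
Lemma char_poly_decomp :
  map_poly (real_complex R) (char_poly M) =
  'X^#|S| * \prod_(j in ~: S) ('X - (d j)%:P).
Proof.
rewrite map_char_poly -/(toC M).
have -> : char_poly (toC M) = char_poly (diag_mx (\row_j d j)).
  rewrite /char_poly /char_poly_mx decompM.
  have polyM (B D : 'M[R[i]]_n) : map_mx polyC (B *m D) = map_mx polyC B *m map_mx polyC D.
    exact: map_mxM.
  set D := diag_mx _; set P := map_mx polyC U.
  have PV : P *m map_mx polyC (invmx U) = 1%:M by rewrite -polyM mulmxV // map_mx1.
  have -> : 'X%:M - map_mx polyC (U *m D *m invmx U) =
      P *m ('X%:M - map_mx polyC D) *m map_mx polyC (invmx U).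
    rewrite mulmxBr mulmxBl !polyM; congr (_ - _).
    by rewrite mul_mx_scalar -scalemxAl PV scalemx1.
  rewrite !det_mulmx mulrAC -det_mulmx PV det1 mul1r //.
rewrite char_poly_trig; last by apply/diag_mx_is_trig.
rewrite (bigID (mem S)) /=; congr (_ * _).
  rewrite (eq_bigr (fun=> 'X)); last first.
    by move=> j jS; rewrite !mxE eqxx ker_d // polyC0 subr0.
  by rewrite prodr_const.
apply: eq_big => j; first by rewrite inE.
by move=> _; rewrite !mxE eqxx.
Qed.

Let q : {poly R[i]} := \prod_(j in ~: S) ('X - (d j)%:P).

Lemma coef_char_poly_shift m :
  real_complex R (char_poly M)`_(#|S| + m) = q`_m.
Proof.
have := congr1 (fun p : {poly R[i]} => p`_(#|S| + m)) char_poly_decomp.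
by rewrite coef_map /= => ->; rewrite coefXnM ltnNge leq_addr /= addKn.
Qed.

Lemma iter_mulmx_decomp m :
  toC (iter m (mulmx M) 1%:M) = U *m diag_mx (\row_j d j ^+ m) *m invmx U.
Proof.
elim: m => [|m IH].
  rewrite /= /toC map_mx1 (_ : diag_mx _ = 1%:M) ?mulmx1 ?mulmxV //.
  by apply/matrixP => a b; rewrite !mxE expr0.
rewrite iterS /toC map_mxM -!/(toC _) IH decompM !mulmxA mulmxKV //.
congr (_ *m _); rewrite -mulmxA mulmx_diag; congr (_ *m diag_mx _).
by apply/rowP => a; rewrite !mxE exprS.
Qed.

Lemma size_q : (size q <= n.+1)%N.
Proof.
rewrite /q -big_enum size_prod_XsubC ltnS -cardE.
by rewrite -[X in (_ <= X)%N](card_ord n) max_card.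
Qed.

Lemma horner_q l : q.[d l] = if l \in S then q`_0 else 0.
Proof.
case: ifPn => lS; first by rewrite ker_d // horner_coef0.
by rewrite /q (bigD1 l) ?inE //= hornerM hornerXsubC subrr mul0r.
Qed.

(** In the eigenbasis q(M) is diagonal with entries q(d_l), that is, q(0) for l
    in S and 0 otherwise: q(M) is q(0) times the spectral projector. *)
Lemma projector_numerator_diag k :
  real_complex R (projector_numerator k k) =
  real_complex R (char_poly M)`_#|S| * \sum_(l in S) participation U k l.
Proof.
rewrite -[X in _`_X]addn0 coef_char_poly_shift.
transitivity (\sum_l participation U k l * q.[d l]).
  rewrite /projector_numerator summxE rmorph_sum /=.
  under [RHS]eq_bigr => l _ do rewrite (horner_coef_wide _ size_q) mulr_sumr.
  rewrite [RHS]exchange_big /=; apply: eq_bigr => m _.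
  rewrite mxE rmorphM /= coef_char_poly_shift.
  transitivity (q`_m * (toC (iter m (mulmx M) 1%:M)) k k); first by rewrite [in RHS]mxE.
  rewrite iter_mulmx_decomp diag_conjugate_entry mulr_sumr.
  by apply: eq_bigr => l _; rewrite mulrCA.
rewrite (bigID (mem S)) /= [X in _ + X]big1 ?addr0; last first.
  by move=> l /negPf lS; rewrite horner_q lS mulr0.
by rewrite mulr_sumr; apply: eq_bigr => l lS; rewrite horner_q lS mulrC.
Qed.

(** Up to sign, q(0) is the product of the eigenvalues outside S. *)
Lemma char_poly_coef_lower_bound delta : 0 <= delta ->
  (forall j, j \notin S -> delta <= Normc.normc (d j)) ->
  delta ^+ #|~: S| <= `|(char_poly M)`_(#|S|)|.
Proof.
move=> delta_ge0 le_d.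
have -> : `|(char_poly M)`_(#|S|)| = Normc.normc (real_complex R (char_poly M)`_#|S|).
  by rewrite /= expr0n addr0 sqrtr_sqr.
rewrite -[X in _`_X]addn0 coef_char_poly_shift -horner_coef0 /q horner_prod.
rewrite (big_morph _ (@Normc.normcM R) (@Normc.normc1 R)) -prodr_const.
apply: ler_prod => j; rewrite inE => jS.
by rewrite delta_ge0 hornerXsubC sub0r normcN le_d.
Qed.

End Projector.

Section ProjectorLimit.
Variables (R : realType) (n : nat) (T : Type) (F : set_system T).
Context {FF : ProperFilter F}.
Variables (M : T -> 'M[R]_n) (M0 : 'M[R]_n) (U : T -> 'M[R[i]]_n).
Variables (d : T -> 'I_n -> R[i]) (S : {set 'I_n}) (delta : R).
Hypothesis MM0 : cvg_entry F M M0.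
Hypothesis delta_gt0 : 0 < delta.

(** The kernel of M t is spanned by the eigenvectors indexed by S, with a
    spectral gap delta that does not depend on t. *)
Definition kernel_split t : Prop := [/\ U t \in unitmx,
  toC (M t) = U t *m diag_mx (\row_j d t j) *m invmx (U t),
  forall j, j \in S -> d t j = 0 &
  forall j, j \notin S -> delta <= Normc.normc (d t j)].

Hypothesis decompM : \forall t \near F, kernel_split t.

Lemma cvg_projector_numerator :
  cvg_entry F (fun t => projector_numerator (M t) S) (projector_numerator M0 S).
Proof.
move=> a b; under [fun t => _]funext do rewrite summxE; rewrite summxE.
apply: cvg_sum_fin => m; under [fun t => _]funext do rewrite mxE; rewrite mxE.
apply: cvgM; first exact: (cvg_char_poly MM0).
move: a b; elim: (m : nat) => [|l IH] a b; first exact: cvg_cst.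
exact: cvg_entryM.
Qed.

(** The entry is a quotient q(M)_kk / q(0); the gap keeps q(0) away from 0. *)
Lemma cvg_projector_diag k : exists L : R,
  complex.Re (\sum_(l in S) participation (U t) k l) @[t --> F] --> L.
Proof.
pose c t := (char_poly (M t))`_#|S|; pose c0 := (char_poly M0)`_#|S|.
have cc0 : c t @[t --> F] --> c0 by exact: (cvg_char_poly MM0).
have c_lb : \forall t \near F, delta ^+ #|~: S| <= `|c t|.
  near=> t; have [Uu dec ker_d le_d] : kernel_split t by near: t.
  exact: (char_poly_coef_lower_bound Uu dec ker_d (ltW delta_gt0)).
have c0_neq0 : c0 != 0.
  rewrite -normr_gt0; apply: lt_le_trans (exprn_gt0 #|~: S| delta_gt0) _.
  exact: cvgr_to_ge (cvg_norm cc0) c_lb.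
exists (projector_numerator M0 S k k / c0).
have lim : projector_numerator (M t) S k k / c t @[t --> F] -->
    projector_numerator M0 S k k / c0.
  by apply: cvgM; [exact: cvg_projector_numerator|exact: cvgV].
apply: cvg_trans lim; apply: near_eq_cvg; near=> t.
have [Uu dec ker_d _] : kernel_split t by near: t.
have c_neq0 : c t != 0.
  rewrite -normr_gt0; apply: lt_le_trans (exprn_gt0 #|~: S| delta_gt0) _.
  by near: t.
have := congr1 (@complex.Re R) (projector_numerator_diag Uu dec ker_d k).
rewrite /= => ->; rewrite -/(c t).
by case: (\sum_(l in S) _) => a b /=; rewrite mul0r subr0 mulrAC divff ?mul1r.
Unshelve. all: by end_near. Qed.

Hypothesis S_neq0 : S != finset.set0.

(** The limits of the diagonal entries add up to the trace #|S| of the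
    projectors, so one of them is nonzero. *)
Lemma participation_sum_bounded_away : exists k : 'I_n, exists2 e : R, 0 < e &
  \forall t \near F, e <= `|complex.Re (\sum_(l in S) participation (U t) k l)|.
Proof.
have [L LE] := choice cvg_projector_diag.
have sumL : 1 <= \sum_k L k.
  apply: cvgr_to_ge (cvg_sum_fin _ LE) _; near=> t.
  have [Uu _ _ _] : kernel_split t by near: t.
  rewrite -Re_sum exchange_big /= (eq_bigr (fun=> 1)); last first.
    by move=> l _; apply: sum_participation.
  rewrite sumr_const -(rmorph_nat (real_complex R)) /= ler1n.
  by rewrite card_gt0.
have [k Lk_neq0] : exists k, L k != 0.
  apply/existsP; apply: contraLR sumL; rewrite negb_exists => /forallP L0.
  by rewrite big1 ?ler10 // => k _; apply/eqP; rewrite -[_ == _]negbK.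
exists k, (`|L k| / 2); first by rewrite divr_gt0 // normr_gt0.
have := cvgr_ge _ (cvg_norm (LE k)); apply.
by rewrite ltr_pdivrMr // ltr_pMr ?normr_gt0 // ltr1n.
Unshelve. all: by end_near. Qed.

End ProjectorLimit.

(** * The projector on the marginal pair *)

Section Spectrum.
Variables (R : realType) (n : nat) (A : 'M[R]_n) (lam : 'I_n -> R[i]).
Variable (U : 'M[R[i]]_n).
Hypothesis eigA : eigensystem A lam U.

(** Sum the moduli of the components of A u = lambda u, for a unit eigenvector
    u: the moduli are at most 1 and add up to at least 1. *)
Lemma eigenvalue_bound j : Normc.normc (lam j) <= \sum_k \sum_l `|A k l|.
Proof.
have sum_ge1 : 1 <= \sum_k Normc.normc (U k j).
  have /(congr1 (@complex.Re R)) := eigen_norm eigA j; rewrite Re_sum [complex.Re 1]/= => <-.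
  apply: ler_sum => k _; rewrite normc_def -rmorphXn /=.
  have -> : Num.sqrt (complex.Re (U k j) ^+ 2 + complex.Im (U k j) ^+ 2) =
    Normc.normc (U k j) by case: (U k j).
  by rewrite expr2 ler_piMl ?normc_ge0 // (normc_eigenvector_le1 eigA).
apply: (@le_trans _ _ (\sum_k Normc.normc (lam j * U k j))).
  rewrite -[leLHS]mulr1; under eq_bigr do rewrite Normc.normcM.
  by rewrite -mulr_sumr ler_wpM2l ?normc_ge0.
apply: ler_sum => k _.
have -> : lam j * U k j = \sum_l toC A k l * U l j.
  have /matrixP/(_ k j) := eigen_right eigA; rewrite mxE => ->.
  by rewrite mul_mx_diag !mxE mulrC.
apply: le_trans (normc_sum _ _) _; apply: ler_sum => l _.
rewrite Normc.normcM mxE /= expr0n addr0 sqrtr_sqr.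
by rewrite ler_piMr // (normc_eigenvector_le1 eigA).
Qed.

Lemma char_poly_eigen s :
  (map_poly (real_complex R) (char_poly A)).[s] = \prod_j (s - lam j).
Proof.
have S0 j : j \in finset.set0 -> lam j = 0 by rewrite inE.
rewrite (char_poly_decomp (eigen_unit eigA) (eigen_decomp eigA) S0).
rewrite cards0 expr0 mul1r horner_prod; apply: eq_big => j; first by rewrite !inE.
by move=> _; rewrite hornerXsubC.
Qed.

End Spectrum.

Section MarginalPair.
Variables (R : realType) (n : nat) (T : Type) (F : set_system T).
Context {FF : ProperFilter F}.
Variables (A : T -> 'M[R]_n) (A0 : 'M[R]_n) (lam : T -> 'I_n -> R[i]).
Variables (U : T -> 'M[R[i]]_n) (i istar : 'I_n) (alpha : R).
Hypothesis AA0 : cvg_entry F A A0.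
Hypothesis lam_i0 : complex.Re (lam t i) @[t --> F] --> 0.
Hypothesis alpha_gt0 : 0 < alpha.

Local Notation S := [set i; istar]%SET.

Definition marginal_pair t : Prop := [/\ eigensystem (A t) (lam t) (U t),
  lam t istar = (lam t i)^* &
  forall j, j \notin S -> complex.Re (lam t j) < - alpha].

Hypothesis marginal : \forall t \near F, marginal_pair t.

Local Notation chi M := (map_poly (real_complex R) (char_poly M)).

(** Coefficientwise convergence is uniform on bounded sets. *)
Lemma cvg_char_poly_eval (s : T -> R[i]) (B : R) :
  (\forall t \near F, Normc.normc (s t) <= B) ->
  Normc.normc ((chi (A t)).[s t] - (chi A0).[s t]) @[t --> F] --> 0.
Proof.
move=> s_le.
pose G t := \sum_(m < n.+1) `|(char_poly (A t))`_m - (char_poly A0)`_m| * B ^+ m.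
have G0 : G t @[t --> F] --> 0.
  suff : G t @[t --> F] -->
      \sum_(m < n.+1) `|(char_poly A0)`_m - (char_poly A0)`_m| * B ^+ m.
    by rewrite big1 // => m _; rewrite subrr normr0 mul0r.
  apply: cvg_sum_fin => m; apply: cvgM; last exact: cvg_cst.
  apply: cvg_norm; apply: cvgB; last exact: cvg_cst.
  exact: (cvg_char_poly AA0).
apply: squeeze_cvgr (cvg_cst 0) G0; near=> t.
have st_le : Normc.normc (s t) <= B by near: t.
rewrite normc_ge0 /=.
have size_chi (M : 'M[R]_n) : (size (chi M) <= n.+1)%N.
  by rewrite size_map_poly size_char_poly.
rewrite !(horner_coef_wide _ (size_chi _)) -sumrB.
apply: le_trans (normc_sum _ _) _; apply: ler_sum => m _.
rewrite !coef_map -mulrBl -rmorphB Normc.normcM /= expr0n addr0 sqrtr_sqr.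
apply: ler_wpM2l => //.
rewrite (_ : Normc.normc (s t ^+ m) = Normc.normc (s t) ^+ m).
  by rewrite lerXn2r ?nnegrE ?normc_ge0 // (le_trans (normc_ge0 _) st_le).
elim: (m : nat) => [|l IH]; first by rewrite !expr0 Normc.normc1.
by rewrite !exprS Normc.normcM IH.
Unshelve. all: by end_near. Qed.

(** Otherwise the modulus of chi A0 at lambda_i, at least the product of the
    distances |Re lambda_i - Re z| to its roots z, would stay away from 0, since
    Re lambda_i tends to 0. But lambda_i is bounded and a root of chi (A t), so
    chi A0 tends to 0 at lambda_i. *)
Lemma limit_has_imaginary_root : exists w : R, root (chi A0) (Complex 0 w).
Proof.
have [r chiE] := closed_field_poly_normal (chi A0).
have chi_monic : chi A0 \is monic by rewrite monic_map ?char_poly_monic.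
rewrite (monicP chi_monic) scale1r in chiE.
have [[z zr z0]|r_neq0] := pselect (exists2 z, z \in r & complex.Re z = 0).
  exists (complex.Im z); rewrite (_ : Complex _ _ = z); last by case: (z) z0 => a b /= ->.
  by rewrite chiE root_prod_XsubC.
exfalso.
pose B := \sum_k \sum_l `|A0 k l| + 1.
have lam_le : \forall t \near F, Normc.normc (lam t i) <= B.
  have sumA : \sum_k \sum_l `|A t k l| @[t --> F] --> \sum_k \sum_l `|A0 k l|.
    by apply: cvg_sum_fin => k; apply: cvg_sum_fin => l; apply: cvg_norm; apply: AA0.
  have sum_le : \forall t \near F, \sum_k \sum_l `|A t k l| <= B.
    by apply: (cvgr_le _ sumA); rewrite ltrDl.
  near=> t; have [eigA _ _] : marginal_pair t by near: t.
  by apply: le_trans (eigenvalue_bound eigA i) _; near: t.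
have chi0 := cvg_char_poly_eval lam_le.
have prodE : \prod_(z <- r) `|complex.Re (lam t i) - complex.Re z| @[t --> F] -->
   \prod_(z <- r) `|complex.Re z|.
  elim: r {chiE r_neq0} => [|z r IH].
    by under [fun t => _]funext do rewrite big_nil; rewrite big_nil; apply: cvg_cst.
  under [fun t => _]funext do rewrite big_cons; rewrite big_cons; apply: cvgM => //.
  suff : `|complex.Re (lam t i) - complex.Re z| @[t --> F] --> `|0 - complex.Re z|.
    by rewrite sub0r normrN.
  by apply: cvg_norm; apply: cvgB => //; apply: cvg_cst.
have : \prod_(z <- r) `|complex.Re z| <= 0.
  rewrite -subr_ge0; apply: cvgr_to_ge (cvgB chi0 prodE) _; near=> t.
  rewrite subr_ge0.
  have [eigA _ _] : marginal_pair t by near: t.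
  rewrite (char_poly_eigen eigA) (bigD1 i) //= subrr mul0r sub0r normcN.
  rewrite chiE horner_prod (big_morph _ (@Normc.normcM R) (@Normc.normc1 R)).
  apply: ler_prod => z _; rewrite normr_ge0 /= hornerXsubC.
  by apply: le_trans (@Re_le_normc R _); rewrite Re_add Re_opp.
apply/negP; rewrite -ltNge big_seq prodr_gt0 // => z zr.
by rewrite normr_gt0; apply/eqP => z0; apply: r_neq0; exists z.
Unshelve. all: by end_near. Qed.

(** For a nonreal pair, let iw be an imaginary root of the limit polynomial.
    The value of chi (A t) at iw tends to 0; the factors outside the pair have
    modulus at least alpha, so (iw - lambda_i) (iw - conj lambda_i) tends to 0,
    and the real part of this product is |lambda_i|^2 - w^2.
    In particular all imaginary roots of the limit have the same modulus. For
    a real lambda_i the limit is 0. *)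
Lemma cvg_sqr_modulus : exists b : R, Normc.normc (lam t i) ^+ 2 @[t --> F] --> b.
Proof.
have [real_i|complex_i] := eqVneq istar i.
  exists (0 ^+ 2 : R).
  apply: cvg_trans (_ : complex.Re (lam t i) ^+ 2 @[t --> F] --> (0 ^+ 2 : R)).
    apply: near_eq_cvg; near=> t; have [_ lam_real _] : marginal_pair t by near: t.
    rewrite sqr_normc_ReIm; rewrite real_i in lam_real.
    have Im0 : complex.Im (lam t i) = 0.
      by have := congr1 (@complex.Im R) lam_real; rewrite Im_conj; lra.
    by rewrite Im0 expr0n addr0.
  by rewrite !expr2; apply: cvgM.
have [w rootw] := limit_has_imaginary_root; pose s := Complex 0 w.
exists (w ^+ 2); pose K := alpha ^+ #|~: S|.
have K_gt0 : 0 < K by rewrite exprn_gt0.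
have chi0 : Normc.normc ((chi (A t)).[s]) @[t --> F] --> 0.
  have := @cvg_char_poly_eval (fun=> s) (Normc.normc s) (nearW _ (fun=> lexx _)).
  by rewrite (rootP rootw); under [fun t => _]funext do rewrite subr0; apply.
pose f t := Normc.normc (lam t i) ^+ 2 - w ^+ 2.
suff f0 : f t @[t --> F] --> 0.
  have : f t + w ^+ 2 @[t --> F] --> 0 + w ^+ 2 by apply: cvgD => //; apply: cvg_cst.
  by rewrite add0r /f; under [fun t => _]funext do rewrite subrK.
have chiK0 : Normc.normc ((chi (A t)).[s]) / K @[t --> F] --> 0.
  suff : Normc.normc ((chi (A t)).[s]) / K @[t --> F] --> 0 / K by rewrite mul0r.
  by apply: cvgM => //; apply: cvg_cst.
apply: norm_cvg0; apply: squeeze_cvgr (cvg_cst 0) chiK0; near=> t.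
have [eigA lam_istar lam_others] : marginal_pair t by near: t.
rewrite normr_ge0 /= ler_pdivlMr // (char_poly_eigen eigA).
rewrite (bigID (mem S)) /= Normc.normcM.
apply: ler_pM; rewrite ?normr_ge0 ?(ltW K_gt0) //.
  rewrite big_setU1 ?inE 1?eq_sym //= big_set1 lam_istar.
  rewrite [f t](_ : _ = complex.Re ((s - lam t i) * (s - (lam t i)^*))).
    exact: Re_le_normc.
  rewrite /f sqr_normc_ReIm /s; case: (lam t i) => a b /=; ring.
rewrite (big_morph _ (@Normc.normcM R) (@Normc.normc1 R)) /K -prodr_const.
rewrite [X in X <= _](eq_bigl (fun j => j \notin S)); last by move=> j; rewrite inE.
apply: ler_prod => j jS; rewrite (ltW alpha_gt0) /=.
apply: le_trans (@Re_le_normc R _); rewrite Re_add Re_opp sub0r normrN.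
have lam_j := lam_others j jS.
by rewrite ler0_norm; [rewrite lerNr ltW|rewrite (ltW (lt_trans lam_j _)) // oppr_lt0].
Unshelve. all: by end_near. Qed.

(** A real matrix that kills exactly the eigenvectors of the pair: its
    eigenvalues are (lam_j - lam_i) (lam_j - lam_istar). The quadratic
    expression also serves for a real lam_i, where both factors agree. *)
Definition pair_annihilator t : 'M[R]_n :=
  A t *m A t - (complex.Re (lam t i) *+ 2) *: A t + (Normc.normc (lam t i) ^+ 2)%:M.

Lemma pair_annihilator_decomp t : eigensystem (A t) (lam t) (U t) ->
  toC (pair_annihilator t) = U t *m
    diag_mx (\row_j ((lam t j - lam t i) * (lam t j - (lam t i)^*))) *m invmx (U t).
Proof.
move=> eigA; have Uu := eigen_unit eigA.
set D := diag_mx (\row_j lam t j).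
set a := real_complex R (complex.Re (lam t i) *+ 2).
set b := real_complex R (Normc.normc (lam t i) ^+ 2).
transitivity (toC (A t) *m toC (A t) - a *: toC (A t) + b%:M).
  by rewrite /toC /pair_annihilator map_mxD map_mxB map_mxM map_mxZ map_scalar_mx.
have -> : diag_mx (\row_j ((lam t j - lam t i) * (lam t j - (lam t i)^*))) =
    D *m D - a *: D + b%:M.
  apply/matrixP => j l; rewrite mul_diag_mx !mxE.
  case: (eqVneq j l) => [->|_]; last by rewrite !mulr0n !mulr0 subr0 addr0.
  rewrite !mulr1n /a /b sqr_normc_ReIm.
  case: (lam t i) (lam t l) => c d [e f]; apply/eqP; rewrite eq_complex /=.
  by apply/andP; split; apply/eqP; ring.
rewrite mulmxDr mulmxDl mulmxBr mulmxBl (eigen_decomp eigA) -/D; congr (_ - _ + _).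
- by rewrite !mulmxA mulmxKV.
- by rewrite -scalemxAr -scalemxAl.
- by rewrite mul_mx_scalar -scalemxAl mulmxV // scalemx1.
Qed.

(** The annihilators converge and, once Re lam_i > - alpha / 2, have the
    spectral gap (alpha / 2)^2. *)
Lemma marginal_participation_bounded_away : exists k : 'I_n, exists2 e : R, 0 < e &
  \forall t \near F,
    e <= `|complex.Re (\sum_(l in S) participation (U t) k l)|.
Proof.
have [b cvg_b] := cvg_sqr_modulus.
pose M0 := A0 *m A0 - (0 *+ 2) *: A0 + b%:M.
apply: (@participation_sum_bounded_away _ _ _ F _ pair_annihilator M0 U
  (fun t j => (lam t j - lam t i) * (lam t j - (lam t i)^*)) _ ((alpha / 2) ^+ 2)).
- move=> k l; rewrite /M0 !mxE; under [fun t => _]funext do rewrite 6!mxE.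
  apply: cvgD; last first.
    by case: (k == l) => /=; [exact: cvg_b|exact: cvg_cst].
  apply: cvgB; first by apply: cvg_sum_fin => j; apply: cvgM; apply: AA0.
  by apply: cvgM; [rewrite !mulr2n; apply: cvgD|exact: AA0].
- by rewrite exprn_gt0 // divr_gt0.
- near=> t; have [eigA lam_istar lam_others] : marginal_pair t by near: t.
  have Re_i : - (alpha / 2) < complex.Re (lam t i).
    by near: t; apply: (cvgr_gt _ lam_i0); rewrite oppr_lt0 divr_gt0.
  split; [exact: eigen_unit eigA|exact: pair_annihilator_decomp| |].
  - move=> j; rewrite !inE => /orP[]/eqP->; first by rewrite subrr mul0r.
    by rewrite lam_istar subrr mulr0.
  - move=> j jS; have lam_j := lam_others j jS.
    have dist : alpha / 2 <= `|complex.Re (lam t j) - complex.Re (lam t i)|.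
      by move: alpha_gt0 => alpha_pos; rewrite ler0_norm; lra.
    have half_ge0 : 0 <= alpha / 2 by rewrite divr_ge0 // ltW.
    rewrite expr2 Normc.normcM ler_pM //; apply: le_trans dist _.
      by rewrite -Re_opp -Re_add; apply: Re_le_normc.
    by rewrite -(Re_conj (lam t i)) -Re_opp -Re_add; apply: Re_le_normc.
- by apply/set0Pn; exists i; rewrite !inE eqxx.
Unshelve. all: by end_near. Qed.
End MarginalPair.

(** * Divergence of the marginal energies *)

Section Divergence.
Variables (R : realType) (T : Type) (F : set_system T).
Context {FF : Filter F}.
Implicit Types (f h X eps : T -> R) (c B m : R).

(** A bounded error B does not matter next to c / (2 eps). *)
Lemma cvg_pinfty_of_vanishing_damping eps f c B : 0 < c ->
  eps t @[t --> F] --> 0 -> (\forall t \near F, 0 < eps t) ->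
  (\forall t \near F, c / (eps t *+ 2) - B <= f t) -> f t @[t --> F] --> +oo.
Proof.
move=> c_gt0 eps0 eps_gt0 f_ge; apply/cvgryPge => K.
(* eps <= c / (2 (|K + B| + 1)) gives c / (2 eps) >= |K + B| + 1. *)
have den_gt0 : 0 < (`|K + B| + 1) *+ 2 by rewrite mulrn_wgt0 // ltr_pwDr.
near=> t; apply: le_trans (_ : c / (eps t *+ 2) - B <= f t); last by near: t.
have e_gt0 : 0 < eps t by near: t.
have e_le : eps t <= c / ((`|K + B| + 1) *+ 2).
  by near: t; apply: (cvgr_le _ eps0); rewrite divr_gt0.
rewrite lerBrDr; apply: le_trans (ler_norm _) _.
rewrite ler_pdivlMr ?mulrn_wgt0 //.
move: e_le; rewrite ler_pdivlMr // => e_le; apply: le_trans e_le.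
by rewrite !mulrnAr mulrC lerMn2r ler_pM2l // lerDl ler01 orbT.
Unshelve. all: by end_near. Qed.

Variables (f X : T -> R) (m B : R).
Hypothesis m_gt0 : 0 < m.
Hypothesis f_oo : f t @[t --> F] --> +oo.
Hypothesis X_near : \forall t \near F, `|X t - m * f t| <= B.

Lemma total_cvg_pinfty : X t @[t --> F] --> +oo.
Proof.
apply/cvgryPge => K; near=> t.
have : `|X t - m * f t| <= B by near: t.
rewrite ler_norml => /andP[le_X _].
have : (K + B) / m <= f t by near: t; move/cvgryPge: f_oo; apply.
rewrite ler_pdivrMr // mulrC.
by move: le_X; lra.
Unshelve. all: by end_near. Qed.

Lemma bounded_share_cvg0 h C : (\forall t \near F, `|h t| <= C) ->
  h t / X t @[t --> F] --> 0.
Proof.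
move=> h_le; have X_gt0 : \forall t \near F, 0 < X t.
  by move/cvgryPgt: total_cvg_pinfty; apply.
have V0 : (X t)^-1 @[t --> F] --> 0 by apply/(gtr0_cvgV0 X_gt0)/total_cvg_pinfty.
have CV0 : C * (X t)^-1 @[t --> F] --> 0.
  suff : C * (X t)^-1 @[t --> F] --> C * 0 by rewrite mulr0.
  by apply: cvgM => //; apply: cvg_cst.
apply: norm_cvg0; apply: squeeze_cvgr (cvg_cst 0) CV0; near=> t.
have Xt_gt0 : 0 < X t by near: t.
rewrite normr_ge0 normrM normfV (gtr0_norm Xt_gt0) ler_wpM2r ?invr_ge0 ?(ltW Xt_gt0) //.
by near: t.
Unshelve. all: by end_near. Qed.

(** From f / X = 1/m - (X - m f) / (m X), where the last term is a bounded
    quantity divided by one that tends to infinity. *)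
Lemma dominant_share_cvg : f t / X t @[t --> F] --> m^-1.
Proof.
have X_gt0 : \forall t \near F, 0 < X t.
  by move/cvgryPgt: total_cvg_pinfty; apply.
have lim : m^-1 - m^-1 * ((X t - m * f t) / X t) @[t --> F] --> m^-1 - m^-1 * 0.
  apply: cvgB; first exact: cvg_cst.
  by apply: cvgM; [exact: cvg_cst|exact: bounded_share_cvg0 X_near].
rewrite mulr0 subr0 in lim; apply: cvg_trans lim; apply: near_eq_cvg; near=> t.
have Xt_gt0 : 0 < X t by near: t.
by field; rewrite !gt_eqF.
Unshelve. all: by end_near. Qed.

End Divergence.

Lemma sum_constant_part (R : realType) (I : finType) (S : {set I}) (E : I -> R) (y : R) :
  {in S, forall j, E j = y} ->
  \sum_j E j - #|S|%:R * y = \sum_(j | j \notin S) E j.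
Proof.
move=> Ey; have sumS : \sum_(j in S) E j = #|S|%:R * y.
  by rewrite (eq_bigr (fun=> y)) // sumr_const mulr_natl.
by rewrite (bigID (mem S)) /= sumS addrAC subrr add0r.
Qed.

Section EnergyEstimates.
Variables (R : realType) (n : nat) (A : 'M[R]_n) (lam : 'I_n -> R[i]).
Variables (U : 'M[R[i]]_n) (i istar k : 'I_n) (alpha C e : R).
Hypothesis eigA : eigensystem A lam U.
Hypothesis stable : forall j, complex.Re (lam j) < 0.
Hypothesis alpha_gt0 : 0 < alpha.
Hypothesis lam_istar : lam istar = (lam i)^*.
Local Notation S := [set i; istar]%SET.
Hypothesis lam_others : forall j, j \notin S -> complex.Re (lam j) < - alpha.
Hypothesis p_le : forall j, Normc.normc (participation U k j) <= C.
Local Notation E := (mode_in_state_energy A lam U (unit_vec R k) k).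
Local Notation B := (\sum_(l < n) C ^+ 2 / alpha).

Lemma nonmarginal_energy_bound j : j \notin S -> `|E j| <= B.
Proof.
move=> jS; rewrite mode_in_state_energy_sum //.
apply: le_trans (ler_norm_sum _ _ _) _; apply: ler_sum => l _.
apply: pair_energy_bound => //; move: (lam_others jS) (stable l); lra.
Qed.

(** The sum over S is p_i when istar = i, and p_i + conj(p_i) otherwise. *)
Lemma marginal_participation_ge : 0 <= e ->
  e <= `|complex.Re (\sum_(l in S) participation U k l)| ->
  (e / 2) ^+ 2 <= complex.Re (participation U k i) ^+ 2.
Proof.
move=> e_ge0; rewrite -[X in _ -> _ <= X]real_normK ?num_real // => e_le.
rewrite lerXn2r ?nnegrE ?divr_ge0 // ler_pdivrMr //; apply: le_trans e_le _.
have [eq_i|neq_i] := eqVneq istar i.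
  by rewrite eq_i finset.setUid big_set1 ler_peMr // ler1n.
rewrite big_setU1 ?inE 1?eq_sym //= big_set1 (participation_conj eigA k lam_istar).
by rewrite Re_add Re_conj -mulr2n normrMn mulr_natr.
Qed.

(** The pairs (i, l) with l in S give the main term, those with l outside S the
    error. *)
Lemma marginal_energy_ge :
  complex.Re (participation U k i) ^+ 2 / (- complex.Re (lam i) *+ 2) - B <= E i.
Proof.
rewrite mode_in_state_energy_sum // [leRHS](bigID (mem S)) /=; apply: lerD.
  have [eq_i|neq_i] := eqVneq istar i.
    rewrite eq_i finset.setUid big_set1 /pair_energy selfterm_energy //.
    rewrite ler_pM2r; last by rewrite invr_gt0 mulrn_wgt0 // oppr_gt0.
    by rewrite sqr_normc_ReIm lerDl sqr_ge0.
  rewrite big_setU1 ?inE 1?eq_sym //= big_set1 /pair_energy.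
  rewrite (participation_conj eigA k lam_istar) lam_istar.
  exact: crossterm_energy.
rewrite lerNl; apply: le_trans (ler_norm _) _; rewrite normrN.
apply: le_trans (ler_norm_sum _ _ _) _; rewrite big_mkcond /=.
apply: ler_sum => l _; case: ifP => lS; last by rewrite divr_ge0 ?sqr_ge0 // ltW.
apply: pair_energy_bound => //; move: (lam_others lS) (stable i); lra.
Qed.

(** The modes of S have equal energies, the others bounded ones. *)
Lemma total_energy_near :
  `|\sum_j E j - #|S|%:R * E i| <= \sum_(j < n) B.
Proof.
have -> : \sum_j E j - #|S|%:R * E i = \sum_(j | j \notin S) E j.
  apply: sum_constant_part => j; rewrite !inE => /orP[]/eqP->; first exact: erefl.
  exact: (mode_in_state_energy_conj eigA stable k lam_istar).
apply: le_trans (ler_norm_sum _ _ _) _; rewrite big_mkcond /=.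
apply: ler_sum => j _; case: ifP => jS; first exact: nonmarginal_energy_bound.
by apply: sumr_ge0 => l _; rewrite divr_ge0 ?sqr_ge0 // ltW.
Qed.

(** The unit eigenvector has |U_ki| <= 1, hence |V_ik| >= |p_i|. *)
Lemma mode_energy_ge (x : R -> 'cV[R]_n) : is_trajectory A (unit_vec R k) x ->
  complex.Re (participation U k i) ^+ 2 / (- complex.Re (lam i) *+ 2) <=
  mode_energy U x i.
Proof.
move=> x_traj; rewrite (mode_energyE eigA stable x_traj).
rewrite ler_pM2r; last by rewrite invr_gt0 mulrn_wgt0 // oppr_gt0.
rewrite -[leLHS]real_normK ?num_real // lerXn2r ?nnegrE ?normc_ge0 //.
apply: le_trans (@Re_le_normc R _) _; rewrite Normc.normcM ler_piMl ?normc_ge0 //.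
exact: normc_eigenvector_le1 eigA _ _.
Qed.

End EnergyEstimates.

(** * Selective growth of the mode-in-state participation factors *)

Theorem mainTheorem4 (R : realType) (n : nat)
    (* A depends smoothly on g in Om; D is the set of parameter values
       considered, and g tends to g0 within D *)
    (Om D : set R) (g0 : R) (A : R -> 'M[R]_n)
    (lam : R -> 'I_n -> R[i]) (U : R -> 'M[R[i]]_n)
    (x : R -> 'I_n -> R -> 'cV[R]_n)
    (i istar : 'I_n) (alpha : R)
    (open_Om : open Om) (A_smooth : smooth_on Om A)
    (sub_D_Om : D `<=` Om) (Om_g0 : Om g0) (D_g0 : closure D g0)
    (A_eigen : forall g, D g -> eigensystem (A g) (lam g) (U g))
    (A_stable : forall g j, D g -> complex.Re (lam g j) < 0)
    (p_bounded : forall k j : 'I_n, exists C : R, forall g, D g ->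
       Normc.normc (participation (U g) k j) < C)
    (lam_istar : forall g, D g -> lam g istar = (lam g i)^*)
    (lam_i_lim : complex.Re (lam g i) @[g --> within D (nbhs g0)] --> 0^'-)
    (alpha_gt0 : 0 < alpha)
    (lam_others : forall g j, D g -> lam g j <> lam g i ->
       lam g j <> (lam g i)^* -> complex.Re (lam g j) < - alpha)
    (* x g k is the trajectory of the system started at the k-th unit vector *)
    (x_traj : forall g k, D g -> is_trajectory (A g) (unit_vec R k) (x g k)) :
  exists k : 'I_n,
    let Ez g := mode_energy (U g) (x g k) i in
    let E g j := mode_in_state_energy (A g) (lam g) (U g) (unit_vec R k) k j in
    let e g j := lyap_participation (A g) (lam g) (U g) (x g k) k j in
    [/\ Ez g @[g --> within D (nbhs g0)] --> +oo,
        (forall g, D g -> complex.Im (lam g i) = 0) ->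
          [/\ E g i @[g --> within D (nbhs g0)] --> +oo,
              e g i @[g --> within D (nbhs g0)] --> (1 : R)
            & forall j, j != i ->
                e g j @[g --> within D (nbhs g0)] --> (0 : R)]
      & (forall g, D g -> complex.Im (lam g i) <> 0) ->
          [/\ E g i @[g --> within D (nbhs g0)] --> +oo,
              E g istar @[g --> within D (nbhs g0)] --> +oo,
              e g i @[g --> within D (nbhs g0)] --> (2^-1 : R),
              e g istar @[g --> within D (nbhs g0)] --> (2^-1 : R)
            & forall j, j != i -> j != istar ->
                e g j @[g --> within D (nbhs g0)] --> (0 : R)]].
Proof.
pose F := within D (nbhs g0).
have FF : ProperFilter F.
  apply: Build_ProperFilter_ex => P; rewrite /F /within /= => nP.
  by have [g [Dg Pg]] := D_g0 _ nP; exists g; apply: Pg.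
have DF : \forall g \near F, D g by apply: withinT.
have AA0 : cvg_entry F A (A g0).
  move=> k l; apply: cvg_trans (_ : A g k l @[g --> nbhs g0] --> A g0 k l).
    by apply: cvg_app; apply: cvg_within.
  by apply: differentiable_continuous; apply/derivable1_diffP; apply: (A_smooth 0).
have lam_i0 : complex.Re (lam g i) @[g --> F] --> 0.
  by apply: cvg_trans lam_i_lim _; apply: cvg_within.
have others g (Dg : D g) j : j \notin [set i; istar]%SET ->
    complex.Re (lam g j) < - alpha.
  have lam_inj := eigen_distinct (A_eigen g Dg).
  rewrite !inE negb_or => /andP[ji jistar]; apply: lam_others => //.
    by move=> /lam_inj/eqP; apply/negP.
  by rewrite -lam_istar // => /lam_inj/eqP; apply/negP.
have marginal : \forall g \near F, marginal_pair A lam U i istar alpha g.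
  near=> g; have Dg : D g by near: g.
  by split; [exact: A_eigen|exact: lam_istar|exact: others].
have [k [e e_gt0 p_ge]] :=
  marginal_participation_bounded_away AA0 lam_i0 alpha_gt0 marginal.
have [Cf CfP] := choice (p_bounded k).
pose C := \sum_j `|Cf j|.
have p_le g (Dg : D g) j : Normc.normc (participation (U g) k j) <= C.
  apply: le_trans (ltW (CfP j g Dg)) _; apply: le_trans (ler_norm _) _.
  by rewrite /C (bigD1 j) //= lerDl sumr_ge0.
pose S := [set i; istar]%SET.
pose E g j := mode_in_state_energy (A g) (lam g) (U g) (unit_vec R k) k j.
pose X g := \sum_j E g j.
pose c := (e / 2) ^+ 2; pose B := \sum_(l < n) C ^+ 2 / alpha.
have c_gt0 : 0 < c by rewrite exprn_gt0 // divr_gt0.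
pose eps g := - complex.Re (lam g i).
have eps0 : eps g @[g --> F] --> 0.
  suff : eps g @[g --> F] --> (- 0 : R) by rewrite oppr0.
  exact: cvgN.
have eps_gt0 : \forall g \near F, 0 < eps g.
  by near=> g; rewrite oppr_gt0; apply: A_stable; near: g.
have damping_ge : \forall g \near F,
    c / (eps g *+ 2) <= complex.Re (participation (U g) k i) ^+ 2 / (eps g *+ 2).
  near=> g; have Dg : D g by near: g.
  have eg_gt0 : 0 < eps g by near: g.
  rewrite ler_pM2r ?invr_gt0 ?mulrn_wgt0 //.
  apply: (marginal_participation_ge (A_eigen g Dg) (lam_istar g Dg) (ltW e_gt0)).
  by near: g.
have Ei_oo : E g i @[g --> F] --> +oo.
  apply: (cvg_pinfty_of_vanishing_damping (B := B) c_gt0 eps0 eps_gt0); near=> g.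
  have Dg : D g by near: g.
  apply: (@le_trans _ _ (complex.Re (participation (U g) k i) ^+ 2 / (eps g *+ 2) - B)).
    by rewrite lerB //; near: g.
  exact: (marginal_energy_ge (A_eigen g Dg) (A_stable g ^~ Dg) alpha_gt0 (lam_istar g Dg)
    (others g Dg) (p_le g Dg)).
have Ez_oo : mode_energy (U g) (x g k) i @[g --> F] --> +oo.
  apply: (cvg_pinfty_of_vanishing_damping (B := 0) c_gt0 eps0 eps_gt0); near=> g.
  have Dg : D g by near: g.
  rewrite subr0.
  apply: (@le_trans _ _ (complex.Re (participation (U g) k i) ^+ 2 / (eps g *+ 2))).
    by near: g.
  exact: (mode_energy_ge i (A_eigen g Dg) (A_stable g ^~ Dg) (x_traj g k Dg)).
have m_gt0 : 0 < #|S|%:R :> R.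
  by rewrite ltr0n card_gt0; apply/set0Pn; exists i; rewrite !inE eqxx.
have X_near : \forall g \near F, `|X g - #|S|%:R * E g i| <= \sum_(j < n) B.
  near=> g; have Dg : D g by near: g.
  exact: (total_energy_near (A_eigen g Dg) (A_stable g ^~ Dg) alpha_gt0 (lam_istar g Dg)
    (others g Dg) (p_le g Dg)).
have lyapE j : \forall g \near F, E g j / X g =
    lyap_participation (A g) (lam g) (U g) (x g k) k j.
  near=> g; have Dg : D g by near: g.
  rewrite /lyap_participation (x_traj g k Dg).1.
  by rewrite (state_energyE (A_eigen g Dg) (A_stable g ^~ Dg) (x_traj g k Dg)).
have share_i : lyap_participation (A g) (lam g) (U g) (x g k) k i @[g --> F] -->
    (#|S|%:R^-1 : R).
  apply: cvg_trans (dominant_share_cvg m_gt0 Ei_oo X_near).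
  by apply: near_eq_cvg; apply: lyapE.
have share_j j : j \notin S ->
    lyap_participation (A g) (lam g) (U g) (x g k) k j @[g --> F] --> 0.
  move=> jS; have Ej_le : \forall g \near F, `|E g j| <= B.
    near=> g; have Dg : D g by near: g.
    exact: (nonmarginal_energy_bound (A_eigen g Dg) (A_stable g ^~ Dg) alpha_gt0
      (others g Dg) (p_le g Dg)).
  apply: cvg_trans (bounded_share_cvg0 m_gt0 Ei_oo X_near Ej_le).
  by apply: near_eq_cvg; apply: lyapE.
(* Since the eigenvalues are distinct, lambda_i is real at a given parameter if
   and only if istar = i; so one parameter decides the case for all. *)
have [g Dg] : exists g, D g by apply: filter_ex DF.
exists k => Ez E' e'; split; first exact: Ez_oo.
- move=> Im0; have eq_i : istar = i.
    apply: (eigen_distinct (A_eigen g Dg)); rewrite lam_istar //.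
    by rewrite (real_complex_Re (Im0 g Dg)); apply: conjc_real.
  have S1 : S = finset.set1 i by rewrite /S eq_i finset.setUid.
  split; first exact: Ei_oo.
    by move: share_i; rewrite S1 cards1 invr1.
  by move=> j ji; apply: share_j; rewrite S1 inE.
- move=> Im_neq0; have neq_i : istar != i.
    apply/eqP => eq_i; have := congr1 (@complex.Im R) (lam_istar g Dg).
    by rewrite eq_i Im_conj => Im_eq; apply: (Im_neq0 g Dg); lra.
  have S2 : #|S| = 2 by rewrite /S cards2 eq_sym neq_i.
  have Estar : \forall g \near F, E g i = E g istar.
    near=> h; have Dh : D h by near: h.
    exact/esym/(mode_in_state_energy_conj (A_eigen h Dh) (A_stable h ^~ Dh) k
      (lam_istar h Dh)).
  split.
  + exact: Ei_oo.
  + by apply: cvg_trans Ei_oo; apply: near_eq_cvg.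
  + by move: share_i; rewrite S2.
  + move: share_i; rewrite S2; apply: cvg_trans; apply: near_eq_cvg.
    apply: filterS3 (lyapE i) (lyapE istar) Estar => h ei estar Eh.
    by rewrite /e' -estar -Eh -ei.
  + by move=> j ji jistar; apply: share_j; rewrite !inE negb_or ji.
Unshelve. all: by end_near. Qed.
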